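(* Let $a$ and $b$ be positive integers and define $p_{a,b}\colon\mathbb{N}^2\to\mathbb{N}$ by \[ p_{a,b}(x,y)=\begin{cases} y\bigl\lfloor\sqrt[b]{y}\,\bigr\rfloor^a+x &\text{if } \bigl\lfloor\sqrt[b]{y}\,\bigr\rfloor>\bigl\lfloor\sqrt[a]{x}\,\bigr\rfloor,\\ x\Bigl(\bigl\lfloor\sqrt[a]{x}\,\bigr\rfloor+1\Bigr)^{b}+y &\text{otherwise}. \end{cases} \] Then $s(x,y)=\max\bigl(\lfloor\sqrt[a]{x}\rfloor,\lfloor\sqrt[b]{y}\rfloor\bigr)$ is a shell numbering for $p_{a,b}$: for all $(x_1,y_1),(x_2,y_2)\in\mathbb{N}^2$, $s(x_1,y_1)<s(x_2,y_2)$ implies $p_{a,b}(x_1,y_1)<p_{a,b}(x_2,y_2)$.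
   Context: $\mathbb{N}$ denotes the set of non-negative integers. *)

(* Defs.v *)
From mathcomp Require Import all_boot all_order all_algebra all_field.
Import GRing.Theory Num.Theory.

Set Implicit Arguments.
Unset Strict Implicit.
Unset Printing Implicit Defensive.

(* For k > 0, [k.-root] maps the nonnegative real n to its nonnegative real
   k-th root (see [rootC_ge0] and [rootCK]), and [Num.truncn] coincides with
   the floor on nonnegative reals. *)
Definition floor_root (k n : nat) : nat :=
  Num.truncn (k.-root (n%:R : algC))%R.

Definition pab (a b x y : nat) : nat :=
  if floor_root b y > floor_root a x
  then y * floor_root b y ^ a + x
  else x * (floor_root a x + 1) ^ b + y.

Definition sab (a b x y : nat) : nat :=
  maxn (floor_root a x) (floor_root b y).

Definition shell_numbering (s f : nat -> nat -> nat) : Prop :=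
  forall x1 y1 x2 y2 : nat, s x1 y1 < s x2 y2 -> f x1 y1 < f x2 y2.

(* Main.v *)
(* Writing m for s(x,y), both branches satisfy m^(a+b) <= p(x,y) < (m+1)^(a+b),
   so the values of p on distinct shells lie in disjoint intervals, ordered as
   the shells are. *)
Require Import Defs.
From mathcomp Require Import all_boot all_order all_algebra all_field.
Import GRing.Theory Num.Theory.

(** For m = s(x,y), each branch of [pab] is a two-digit number in radix m^a or (m+1)^b: the low
    digit stays below the radix, and the high digit has floor root m. This gives the bounds in
    [pab_itv]; the intervals are ordered by m. *)

Lemma floor_root_itv k n : 0 < k ->
  floor_root k n ^ k <= n < (floor_root k n).+1 ^ k.
Proof.
move=> k_gt0; rewrite /floor_root.
have r_ge0 : (0 <= k.-root (n%:R : algC))%R by rewrite rootC_ge0 // ler0n.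
have /andP[lo hi] := truncn_itv r_ge0.
have rk := rootCK k_gt0 (n%:R : algC)%R.
move: (Num.truncn _) lo hi => m lo hi.
(* In [algC], n is the k-th power of its root, so monotonicity of powers transfers [lo] and [hi]. *)
rewrite -(ler_nat algC) -(ltr_nat algC) !natrX -rk.
by rewrite lerXn2r ?ltrXn2r ?nnegrE ?ler0n // -lt0n k_gt0.
Qed.

Lemma pab_itv a b x y : 0 < a -> 0 < b ->
  sab a b x y ^ (a + b) <= pab a b x y < (sab a b x y).+1 ^ (a + b).
Proof.
move=> ha hb; rewrite /pab /sab.
have /andP[xlo xhi] := floor_root_itv a x ha.
have /andP[ylo yhi] := floor_root_itv b y hb.
move: (floor_root a x) (floor_root b y) xlo xhi ylo yhi => p q xlo xhi ylo yhi.
(* [ltnP] also replaces the maximum by the larger floor root. *)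
case: ltnP => [ltpq | leqp]; rewrite ?addn1 !expnD.
  apply/andP; split.
    by rewrite mulnC (leq_trans _ (leq_addr _ _)) // leq_mul2r ylo orbT.
  (* As p+1 <= q, x is below the radix q^a, so y*q^a + x < (y+1)*q^a. *)
  have ltx : x < q ^ a by rewrite (leq_trans xhi) // leq_exp2r.
  rewrite -addnS (leq_trans (leq_add (leqnn _) ltx)) // -mulSnr mulnC.
  by rewrite leq_mul // leq_exp2r.
have lty : y < p.+1 ^ b by rewrite (leq_trans yhi) // leq_exp2r.
apply/andP; split.
  by rewrite (leq_trans _ (leq_addr _ _)) // leq_mul // leq_exp2r.
rewrite -addnS (leq_trans (leq_add (leqnn _) lty)) // -mulSnr.
by rewrite leq_mul2r xhi orbT.
Qed.

Theorem theorem5p4 (a b : nat) (ha : 0 < a) (hb : 0 < b) :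
  shell_numbering (sab a b) (pab a b).
Proof.
move=> x1 y1 x2 y2 lt12.
have /andP[_ hi1] := pab_itv a b x1 y1 ha hb.
have /andP[lo2 _] := pab_itv a b x2 y2 ha hb.
apply: leq_trans hi1 (leq_trans _ lo2).
by rewrite leq_exp2r // addn_gt0 ha.
Qed.
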